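(* Let $p,d,d_1,d_2$ be positive integers, let $\alpha>0$ and $\sigma_i>0$, $i=1,\dots,p$. Let $[\nu_{ij}(\cdot,\cdot)]_{i,j=1}^p$ be a matrix of continuous functions $\nu_{ij}:[-1,1]^2\to(0,\infty)$ such that $\nu_{ij}(\cdot,\cdot)=(\nu_{ii}(\cdot,\cdot)+\nu_{jj}(\cdot,\cdot))/2$. Let $$\rho_{ij}(s,r)=\beta_{ij}\,\frac{\Gamma(\nu_{ij}(s,r))}{\Gamma(\nu_{ij}(s,r)+d/2)},\qquad s,r\in[-1,1],$$ where $[\beta_{ij}]_{i,j=1}^p$ is a real matrix with $\beta_{ii}=1$. Assume that for any $0<a\le1$ the matrix valued function $(s,r)\mapsto[\beta_{ij}\,a^{\nu_{ij}(s,r)}]_{i,j=1}^p$ is positive definite on $\mathbb{T}^{d_1,d_2}$. Let $\boldsymbol{K}:[-1,1]\times[-1,1]\times[0,\infty)\to\mathbb{R}^{p\times p}$ have elements $$K_{ij}(s,r,h)=\sigma_i\sigma_j\,\rho_{ij}(s,r)\,\mathcal{M}\big(h;\alpha,\nu_{ij}(s,r)\big).$$ Then $\boldsymbol{K}$ is positive definite on $\mathbb{T}^{d_1,d_2}\times\mathbb{R}^d$.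
   Context: $\mathbb{S}^{n}$ is the unit sphere of $\mathbb{R}^{n+1}$; $\mathbb{T}^{d_1,d_2}=\mathbb{S}^{d_1}\times\mathbb{S}^{d_2}$; $\langle\cdot,\cdot\rangle$ is the Euclidean dot product and $\|\cdot\|$ the Euclidean norm. For a nonempty set $X$, a matrix valued function $\boldsymbol{G}:X\times X\to\mathbb{R}^{p\times p}$ satisfying $\boldsymbol{G}(x,y)=\boldsymbol{G}(y,x)^\top$ is positive definite if $\sum_{k,h=1}^N\boldsymbol{a}_k^\top\boldsymbol{G}(x_k,x_h)\boldsymbol{a}_h\ge0$ for all $N$, all $x_1,\dots,x_N\in X$ and all $\boldsymbol{a}_1,\dots,\boldsymbol{a}_N\in\mathbb{R}^p$. A function $\boldsymbol{K}(s,r,h)$ is called positive definite on $\mathbb{T}^{d_1,d_2}\times\mathbb{R}^d$ if the kernel $\big((x_1,x_2,\mathbf{u}),(x_1',x_2',\mathbf{u}')\big)\mapsto\boldsymbol{K}(\langle x_1,x_1'\rangle,\langle x_2,x_2'\rangle,\|\mathbf{u}-\mathbf{u}'\|)$ is positive definite; a function $\boldsymbol{G}(s,r)$ is called positive definite on $\mathbb{T}^{d_1,d_2}$ if $\big((x_1,x_2),(x_1',x_2')\big)\mapsto\boldsymbol{G}(\langle x_1,x_1'\rangle,\langle x_2,x_2'\rangle)$ is positive definite. The Mat\'ern family is, for $\alpha,\nu>0$, $$\mathcal{M}(h;\alpha,\nu)=\frac{2^{1-\nu}}{\Gamma(\nu)}(\alpha h)^{\nu}\mathcal{K}_\nu(\alpha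 h),\qquad h\ge0,$$ where $\mathcal{K}_\nu$ is the modified Bessel function of the second kind of order $\nu$, and the value at $h=0$ is understood by continuity, $\mathcal{M}(0;\alpha,\nu)=1$. *)

(* Defs.v *)
From HB Require Import structures.
From mathcomp Require Import all_boot all_order all_algebra.
From mathcomp Require Import all_classical all_reals all_analysis.
Set Implicit Arguments.
Unset Strict Implicit.
Unset Printing Implicit Defensive.
Import Order.TTheory GRing.Theory Num.Theory.
Import numFieldNormedType.Exports.
Local Open Scope classical_set_scope.
Local Open Scope ring_scope.

Section Euclidean.
Context {R : realType}.

Definition dotv n (u v : 'rV[R]_n) : R := \sum_(i < n) u 0 i * v 0 i.

(* The library norm `|u| on row vectors is the sup norm. *)
Definition enorm n (u : 'rV[R]_n) : R := Num.sqrt (dotv u u).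

End Euclidean.

Definition sphere {R : realType} n : set 'rV[R]_n.+1 := [set x | enorm x = 1].
Arguments sphere {R} n _.

Definition torus {R : realType} d1 d2 : set ('rV[R]_d1.+1 * 'rV[R]_d2.+1) :=
  sphere d1 `*` sphere d2.
Arguments torus {R} d1 d2 _.

Section PositiveDefinite.
Context {R : realType}.

(* Positive definiteness on the subset X of the type T.  The requirement
   G x y = (G y x)^T is part of the notion. *)
Definition posdef_kernel (T : Type) (X : set T) p (G : T -> T -> 'M[R]_p) :=
  (forall x y, X x -> X y -> G x y = (G y x)^T) /\
  (forall N (x : 'I_N -> T) (a : 'I_N -> 'cV[R]_p),
     (forall k, X (x k)) ->
     0 <= \sum_(k < N) \sum_(h < N) ((a k)^T *m G (x k) (x h) *m a h) 0 0).

Definition posdef_torus d1 d2 p (G : R -> R -> 'M[R]_p) :=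
  posdef_kernel (torus d1 d2)
    (fun x y => G (dotv x.1 y.1) (dotv x.2 y.2)).

Definition posdef_torus_space d1 d2 d p (K : R -> R -> R -> 'M[R]_p) :=
  posdef_kernel (torus d1 d2 `*` [set: 'rV[R]_d])
    (fun x y => K (dotv x.1.1 y.1.1) (dotv x.1.2 y.1.2) (enorm (x.2 - y.2))).

End PositiveDefinite.

Section SpecialFunctions.
Context {R : realType}.
Local Notation mu := (@lebesgue_measure R).

(* Euler's integral; only meaningful for x > 0. *)
Definition Gamma (x : R) : R :=
  \int[mu]_(t in `]0, +oo[) (t `^ (x - 1) * expR (- t)).

Definition cosh (x : R) : R := (expR x + expR (- x)) / 2.

(* Modified Bessel function of the second kind, by its classical integral
   formula K_nu(x) = int_0^oo e^{-x cosh t} cosh(nu t) dt, valid for x > 0 and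
   every real order, integer or not. *)
Definition besselK (nu x : R) : R :=
  \int[mu]_(t in `[0, +oo[) (expR (- (x * cosh t)) * cosh (nu * t)).

Definition Matern (h alpha nu : R) : R :=
  if h == 0 then 1
  else 2 `^ (1 - nu) / Gamma nu * (alpha * h) `^ nu * besselK nu (alpha * h).

End SpecialFunctions.

(* Main.v *)
Require Import Defs.
From mathcomp Require Import all_boot all_order all_algebra.
From mathcomp Require Import all_classical all_reals all_analysis.
From mathcomp Require Import measurable_realfun ring lra.
Set Implicit Arguments.
Unset Strict Implicit.
Unset Printing Implicit Defensive.
Import Order.TTheory GRing.Theory Num.Theory.
Import numFieldNormedType.Exports.
Local Open Scope classical_set_scope.
Local Open Scope ring_scope.

(** The Matern function has the spectral density
    [C * Gamma (nu + d/2) / Gamma nu * alpha^(2 nu) (alpha^2 + |x|^2)^(-nu-d/2)]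
    on [R^d].  The factor [Gamma nu / Gamma (nu + d/2)] in [rho] cancels the
    Gamma factors, so up to a positive constant the entry [K i j] is the
    integral over the frequencies [x] of
    [sigma i * sigma j * beta i j * a(x)^nu * cos <x, u> * (alpha^2 + |x|^2)^(-d/2)]
    with [a(x) = alpha^2 / (alpha^2 + |x|^2)] in [(0, 1]].  For each frequency
    the matrix [beta i j * a^nu] is positive definite on the torus by
    assumption, the cosine is positive definite on [R^d], and the Schur product
    and the integral of positive definite kernels are positive definite.

    The proof below takes the Fourier transform one coordinate at a time, and so
    needs integrals over the line and the plane only.  Its central object is
    [gig_mass n c q = int_0^oo s^(n-1) exp (- c s - q/s) ds], written over the
    whole line with [s = expR t].  It covers all the special functions at hand:
    [GammaE] is the case [c = 1, q = 0], and [besselKE] and [Gamma_Matern] give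
    [Gamma nu * Matern h alpha nu = gig_mass nu 1 ((alpha * h)^2 / 4)].  Fubini
    and the cosine transform of a Gaussian ([integral_cos_expRN_sqr]) give
    [cos_gig_mass]:
    [sqrt pi * gig_mass n c (q + v^2/4) =
       int_x cos (v x) * gig_mass (n + 1/2) (c + x^2) q],
    a mixture of cosines in the coordinate [v] whose weights no longer depend on
    [v].  Applied [d] times it removes all the coordinates of [u]; each step
    raises the order by 1/2, which is where [nu + d/2] comes from, and what is
    left is [gig_mass n c 0 = Gamma n * c^(-n)], that is the hypothesis at
    [a = c^-1].  This induction is [quad_ge0_gig_mass]. *)

Local Notation mu := (@lebesgue_measure _).

(** * Integrals over the line *)

Lemma ge0_integral_shift (R : realType) (G : R -> R) (a : R) :
  continuous G -> (forall x, 0 <= G x) ->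
  (\int[mu]_x (G x)%:E = \int[mu]_x (G (x + a))%:E)%E.
Proof.
move=> cG G0.
have F'E : (fun x : R => x + a)^`()%classic = cst 1.
  by apply/funext => x; rewrite derive1E derive_val addr0.
rewrite (@increasing_ge0_integration_by_substitutionT _ (fun x => x + a) G)//.
- by apply: eq_integral => x _; rewrite F'E /= mulr1.
- by move=> x y xy; rewrite ltrD2r.
- by rewrite F'E => x; exact: cvg_cst.
- by rewrite F'E; exact: is_cvg_cst.
- by rewrite F'E; exact: is_cvg_cst.
- exact: cvg_addrr_Ny.
- exact: cvg_addrr.
Qed.

Lemma ge0_integral_scale (R : realType) (G : R -> R) (a : R) : 0 < a ->
  continuous G -> (forall x, 0 <= G x) ->
  (\int[mu]_x (G x)%:E = \int[mu]_x (G (x * a) * a)%:E)%E.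
Proof.
move=> a0 cG G0.
have F'E : (fun x : R => x * a)^`()%classic = cst a.
  by apply/funext => x; rewrite derive1E derive_val scaler0 add0r [LHS]mulr1.
rewrite (@increasing_ge0_integration_by_substitutionT _ (fun x => x * a) G)//.
- by apply: eq_integral => x _; rewrite F'E.
- by move=> x y xy; rewrite ltr_pM2r.
- by rewrite F'E => x; exact: cvg_cst.
- by rewrite F'E; exact: is_cvg_cst.
- by rewrite F'E; exact: is_cvg_cst.
- exact: gt0_cvgMlNy.
- exact: gt0_cvgMly.
Qed.

(** The half line is the domain of the integral that defines [besselK]. *)
Lemma ge0_integral_fold (R : realType) (G : R -> R) :
  continuous G -> (forall x, 0 <= G x) ->
  (\int[mu]_x (G x)%:E = \int[mu]_(x in `[0%R, +oo[) (G x + G (- x))%:E)%E.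
Proof.
move=> cG G0.
have mG : measurable_fun setT G by exact: continuous_measurable_fun.
have cGN : continuous (G \o -%R).
  by move=> x; apply: continuous_comp; [exact: opp_continuous|exact: cG].
under [RHS]eq_integral do rewrite EFinD.
rewrite ge0_integralD//=; last 4 first.
- by move=> x _; rewrite lee_fin.
- exact/measurable_EFinP/measurable_funTS.
- by move=> x _; rewrite lee_fin.
- apply/measurable_EFinP/measurable_funTS; exact: continuous_measurable_fun.
rewrite -ge0_integration_by_substitutionNy//; last exact: continuous_subspaceT.
rewrite oppr0 -integral_itv_bndo_bndc; last exact/measurable_EFinP/measurable_funTS.
rewrite -ge0_integral_setU//=; first last.
- rewrite disj_set2E; apply/eqP; rewrite -subset0 => x/=.
  by rewrite !in_itv/= andbT leNgt => -[/negP].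
- by move=> x _; rewrite lee_fin.
- exact/measurable_EFinP/measurable_funTS.
by rewrite -setCitvl setvU.
Qed.

Lemma bigcup_itvN_nat (R : realType) :
  \bigcup_n `[- n%:R, n%:R]%classic = [set: R].
Proof.
apply/seteqP; split => // x _; exists (Num.trunc `|x|).+1 => //=.
by rewrite in_itv/= -ler_norml ltW// truncnS_gt.
Qed.

Lemma bigcup_itv_expR_nat (R : realType) :
  \bigcup_n `[expR (- n%:R), expR n%:R]%classic = `]0, +oo[%classic :> set R.
Proof.
apply/seteqP; split => x /=.
  by move=> [n _]; rewrite /= !in_itv/= andbT => /andP[+ _]; apply/lt_le_trans/expR_gt0.
rewrite in_itv/= andbT => x0.
have [n _] : (\bigcup_n `[- n%:R, n%:R]%classic : set R) (ln x) by rewrite bigcup_itvN_nat.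
rewrite /= in_itv/= => nx; exists n => //=.
by rewrite in_itv/= -(lnK x0) !ler_expR.
Qed.

(** The derivative of [expR] is unbounded at infinity, so the substitution is
    made on the segments from [- n] to [n], which exhaust the line. *)
Lemma ge0_integral_expR (R : realType) (G : R -> R) :
  {in `]0, +oo[, continuous G} -> (forall x, 0 <= G x) ->
  (\int[mu]_(x in `]0%R, +oo[) (G x)%:E = \int[mu]_x (G (expR x) * expR x)%:E)%E.
Proof.
move=> cG G0.
have dE : (@expR R)^`()%classic = expR.
  by apply/funext => x; rewrite derive1E derive_val.
have cE := @continuous_expR R.
have mG : measurable_fun (`]0, +oo[%classic : set R) G.
  by apply: open_continuous_measurable_fun => // x /set_mem; exact: cG.
have cGE : continuous (fun x => G (expR x) * expR x).
  move=> x; apply: cvgM; last exact: cE.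
  apply: continuous_comp; first exact: cE.
  by apply: cG; rewrite in_itv/= andbT expR_gt0.
have L : (\int[mu]_(x in `[expR (- n%:R), expR n%:R]) (G x)%:E @[n --> \oo] -->
          \int[mu]_(x in `]0%R, +oo[) (G x)%:E)%E.
  rewrite -bigcup_itv_expR_nat; apply: ge0_nondecreasing_set_cvg_integral => //.
  - move=> m n mn; rewrite subsetEset => x /=; rewrite !in_itv/= => /andP[xm xn].
    rewrite (le_trans _ xm) ?(le_trans xn)// ler_expR ?lerN2 ler_nat//.
  - move=> n; apply/measurable_EFinP; apply: measurable_funS mG => //.
    rewrite -bigcup_itv_expR_nat => x xn; by exists n.
  - by move=> *; rewrite lee_fin.
have L' : (\int[mu]_(x in `[(- n%:R)%R, n%:R%R]) (G (expR x) * expR x)%:E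
          @[n --> \oo] -->
          \int[mu]_x (G (expR x) * expR x)%:E)%E.
  rewrite -bigcup_itvN_nat; apply: ge0_nondecreasing_set_cvg_integral => //.
  - move=> m n mn; rewrite subsetEset => x /=; rewrite !in_itv/= => /andP[xm xn].
    rewrite (le_trans _ xm) ?(le_trans xn)// ?lerN2 ler_nat//.
  - move=> n; apply/measurable_EFinP/measurable_funTS.
    exact: continuous_measurable_fun.
  - by move=> *; rewrite lee_fin mulr_ge0 ?expR_ge0.
apply: (cvg_unique (@ereal_hausdorff R) L); apply: cvg_trans L'.
apply: near_eq_cvg; near=> n.
rewrite [RHS]integration_by_substitution_increasing ?dE//.
- by rewrite ge0_cp ?ler0n.
- by move=> x y _ _; rewrite ltr_expR.
- by apply/cvg_ex; exists (expR (- n%:R)); apply: cvg_at_right_filter; exact: cE.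
- by apply/cvg_ex; exists (expR n%:R); apply: cvg_at_left_filter; exact: cE.
- split; first by move=> x _; exact: derivable_expR.
  + by apply: cvg_at_right_filter; exact: cE.
  + by apply: cvg_at_left_filter; exact: cE.
- apply/subspace_continuousP => x /=; rewrite in_itv/= => /andP[nx _].
  apply: cvg_within_filter; apply: cG.
  by rewrite in_itv/= andbT (lt_le_trans _ nx)// expR_gt0.
Unshelve. all: by end_near. Qed.

(** The integral over the segment from [- n] to [n] is [g n - g (- n)], and these
    integrals converge to the whole one by dominated convergence.  This is
    integration by parts without boundary terms, for [g] a product. *)
Lemma integral_derive_eq0 (R : realType) (g g' : R -> R) :
  (forall x : R, is_derive x 1 g (g' x)) -> continuous g' ->
  mu.-integrable setT (EFin \o g') ->
  g x @[x --> +oo] --> 0 -> g x @[x --> -oo] --> 0 ->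
  \int[mu]_x g' x = 0.
Proof.
move=> dg cg' ig' gy gNy.
have cg : continuous g.
  by move=> x; apply/differentiable_continuous/derivable1_diffP.
have mg' : measurable_fun setT g' by exact: continuous_measurable_fun.
pose f_ (n : nat) := EFin \o (g' \_ (`[- n%:R, n%:R]%classic : set R)).
have [] := @dominated_convergence _ _ R mu setT measurableT f_ (EFin \o g')
  (abse \o (EFin \o g')).
- move=> n; apply/measurable_EFinP.
  by apply/(measurable_restrictT _ _).1 => //; exact: measurable_funTS.
- exact/measurable_EFinP.
- apply: aeW => x _; apply: cvg_near_cst.
  near=> n; rewrite /f_ /= patchE mem_set//=.
  rewrite in_itv/= -ler_norml; near: n; exact: nbhs_infty_ger.
- exact: integrable_abse.
- apply: aeW => x n _ /=; rewrite /f_/= lee_fin patchE; case: ifPn => // _.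
  by rewrite normr0.
move=> _ _ L.
have fE n : (\int[mu]_x f_ n.+1 x)%E = (g n.+1%:R - g (- n.+1%:R))%:E.
  rewrite /f_ -(@restrict_EFin _ _ _ _) -integral_mkcond (@continuous_FTC2 _ g' g)//.
  - by rewrite (@lt_le_trans _ _ 0) ?oppr_lt0 ?ltr0n.
  - exact: continuous_subspaceT.
  - split; first by move=> x _.
    + by apply: cvg_at_right_filter; exact: cg.
    + by apply: cvg_at_left_filter; exact: cg.
  - by move=> x _; rewrite derive1E derive_val.
have L0 : (\int[mu]_x f_ n x)%E @[n --> \oo] --> 0%E.
  rewrite -cvg_shiftS; under eq_fun do rewrite fE.
  apply: cvg_EFin; first by near=> n.
  rewrite /= -[0]subr0; apply: cvgB.
    by apply: (cvg_comp _ _ _ gy); rewrite cvg_shiftS; exact: cvgr_idn.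
  apply: (cvg_comp _ _ _ gNy).
  apply: (proj2 (cvgNrNy (fun n : nat => n.+1%:R : R))).
  by rewrite cvg_shiftS; exact: cvgr_idn.
by rewrite /Rintegral (cvg_unique (@ereal_hausdorff R) L L0).
Unshelve. all: by end_near. Qed.

(** * The cosine transform of a Gaussian *)

Lemma is_derive_continuous (R : realType) (f f' : R -> R) :
  (forall x : R, is_derive x 1 f (f' x)) -> continuous f.
Proof. by move=> df x; apply/differentiable_continuous/derivable1_diffP. Qed.

Lemma is_derive_expRN_sqr (R : realType) (s x : R) :
  is_derive x 1 (fun x : R => expR (- (s * x ^+ 2)))
    (- (2 * s * x) * expR (- (s * x ^+ 2))).
Proof. by apply: trigger_derive; rewrite /GRing.scale /=; ring. Qed.

Lemma continuous_expRN_sqr (R : realType) (s : R) :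
  continuous (fun x : R => expR (- (s * x ^+ 2))).
Proof. by apply: is_derive_continuous => x; exact: is_derive_expRN_sqr. Qed.

Lemma integral_expRN_sqr (R : realType) (s : R) : 0 < s ->
  (\int[mu]_x (expR (- (s * x ^+ 2)))%:E = (Num.sqrt pi / Num.sqrt s)%:E)%E.
Proof.
move=> s0; have rs0 : 0 < Num.sqrt s by rewrite sqrtr_gt0.
rewrite EFinM -integralT_gauss muleC -ge0_integralZl//=; last 2 first.
- by apply/measurable_EFinP; exact: measurable_gauss_fun.
- by move=> x _; rewrite lee_fin gauss_fun_ge0.
rewrite (@ge0_integral_scale _ (fun x => (Num.sqrt s)^-1 * gauss_fun x) _ rs0).
- apply: eq_integral => x _; congr EFin.
  rewrite /gauss_fun exprMn sqr_sqrtr ?ltW// [s * _]mulrC; field.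
  by rewrite gt_eqF.
- by move=> x; apply: cvgMr; exact: continuous_gauss_fun.
- by move=> x; rewrite mulr_ge0 ?gauss_fun_ge0// invr_ge0 ltW.
Qed.

Lemma integrable_expRN_sqr (R : realType) (s : R) : 0 < s ->
  mu.-integrable setT (EFin \o (fun x : R => expR (- (s * x ^+ 2)))).
Proof.
move=> s0; apply/integrableP; split.
  apply/measurable_EFinP; apply: continuous_measurable_fun.
  exact: continuous_expRN_sqr.
under eq_integral do rewrite /= ger0_norm ?expR_ge0//.
by rewrite integral_expRN_sqr// ltry.
Qed.

(** [|x| <= exp (1/(2s)) exp (s x^2/2)] lets half of the exponent absorb the
    linear factor. *)
Lemma integrable_normr_expRN_sqr (R : realType) (s : R) : 0 < s ->
  mu.-integrable setT (EFin \o (fun x : R => `|x| * expR (- (s * x ^+ 2)))).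
Proof.
move=> s0; have s20 : 0 < s / 2 by rewrite divr_gt0.
pose C := expR ((2 * s)^-1).
have iC : mu.-integrable setT
    (fun x : R => (C%:E * (EFin \o (fun x => expR (- (s / 2 * x ^+ 2)))) x)%E).
  by apply: integrableZl => //; exact: integrable_expRN_sqr.
apply: le_integrable iC => //.
  apply/measurable_EFinP; apply: measurable_funM; first exact: normr_measurable.
  apply: continuous_measurable_fun; exact: continuous_expRN_sqr.
move=> x _ /=; rewrite lee_fin [leLHS]ger0_norm; last first.
  by rewrite mulr_ge0 ?expR_ge0.
rewrite [leRHS]ger0_norm; last by rewrite mulr_ge0 ?expR_ge0.
rewrite /C -expRD.
rewrite (_ : _ + _ = (2 * s)^-1 + s / 2 * x ^+ 2 - s * x ^+ 2); last first.
  by field; lra.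
rewrite [leRHS]expRD ler_pM2r ?expR_gt0//.
apply: le_trans (expR_ge1Dx _).
(* Completing the square. *)
have -> : `|x| =
    ((2 * s)^-1 + s / 2 * x ^+ 2) - (2 * s)^-1 * (s * `|x| - 1) ^+ 2.
  rewrite -[x ^+ 2]real_normK ?num_real//; field; lra.
rewrite (@le_trans _ _ ((2 * s)^-1 + s / 2 * x ^+ 2))// ?lerDr// lerBlDr lerDl.
by rewrite mulr_ge0 ?sqr_ge0// invr_ge0 mulr_ge0// ltW.
Qed.

Lemma cvg_expRN_sqr (R : realType) (s : R) : 0 < s ->
  expR (- (s * x ^+ 2)) @[x --> +oo] --> (0 : R).
Proof.
move=> s0; have rs0 : 0 < Num.sqrt s by rewrite sqrtr_gt0.
have -> : (fun x : R => expR (- (s * x ^+ 2))) = gauss_fun \o ( *%R^~ (Num.sqrt s)).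
  by apply/funext => x; rewrite /gauss_fun/= exprMn sqr_sqrtr ?ltW// mulrC.
apply: cvg_comp; last exact: cvg_gauss_fun.
exact: gt0_cvgMly.
Qed.

Lemma cvg_sin_expRN_sqr (R : realType) (s v : R) : 0 < s ->
  sin (v * x) * expR (- (s * x ^+ 2)) @[x --> +oo] --> (0 : R).
Proof.
move=> s0; apply/norm_cvg0P.
apply: (@squeeze_cvgr _ _ _ _ (cst 0) (fun x => expR (- (s * x ^+ 2)))).
- near=> x; rewrite normr_ge0/= normrM (ger0_norm (expR_ge0 _)).
  by rewrite ler_piMl ?expR_ge0// ler_norml sin_geN1 sin_le1.
- exact: cvg_cst.
- exact: cvg_expRN_sqr.
Unshelve. all: by end_near. Qed.

Lemma integrable_cos_expRN_sqr (R : realType) (s v : R) : 0 < s ->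
  mu.-integrable setT (EFin \o (fun x : R => cos (v * x) * expR (- (s * x ^+ 2)))).
Proof.
move=> s0; have ig := integrable_expRN_sqr s0.
apply: le_integrable ig => //.
  apply/measurable_EFinP; apply: measurable_funM; last first.
    apply: continuous_measurable_fun; exact: continuous_expRN_sqr.
  apply: measurableT_comp => //; apply: continuous_measurable_fun.
  exact: continuous_cos.
move=> x _ /=; rewrite lee_fin normrM ler_piMl// ler_norml.
by rewrite cos_geN1 cos_le1.
Qed.

Lemma integrable_sin_expRN_sqr (R : realType) (s v : R) : 0 < s ->
  mu.-integrable setT
    (EFin \o (fun x : R => x * sin (v * x) * expR (- (s * x ^+ 2)))).
Proof.
move=> s0; have ig := integrable_normr_expRN_sqr s0.
apply: le_integrable ig => //.
  apply/measurable_EFinP; apply: measurable_funM; last first.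
    apply: continuous_measurable_fun; exact: continuous_expRN_sqr.
  apply: measurable_funM => //; apply: measurableT_comp => //.
  apply: continuous_measurable_fun; exact: continuous_sin.
move=> x _ /=; rewrite lee_fin !normrM normr_id ler_wpM2r// ler_piMr//.
by rewrite ler_norml sin_geN1 sin_le1.
Qed.

Lemma is_derive_cos_expRN_sqr (R : realType) (s v : R) : 0 < s ->
  is_derive v 1 (fun v => \int[mu]_x (cos (v * x) * expR (- (s * x ^+ 2))))
    (- \int[mu]_x (x * sin (v * x) * expR (- (s * x ^+ 2)))).
Proof.
move=> s0.
pose f (v x : R) := cos (v * x) * expR (- (s * x ^+ 2)).
have df (u x : R) : is_derive u 1 (f ^~ x)
    (- (x * sin (u * x) * expR (- (s * x ^+ 2)))).
  by rewrite /f; apply: trigger_derive; rewrite /GRing.scale /=; ring.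
have d1f (u x : R) : partial1of2 f u x = - (x * sin (u * x) * expR (- (s * x ^+ 2))).
  by rewrite partial1of2E derive_val.
have vI : `]v - 1, v + 1[%classic v by rewrite /= in_itv/=; lra.
have intf (u : R) : `]v - 1, v + 1[%classic u -> mu.-integrable setT (EFin \o f u).
  by move=> _; exact: integrable_cos_expRN_sqr.
have derf (u x : R) : `]v - 1, v + 1[%classic u -> setT x -> derivable (f ^~ x) u 1.
  by move=> _ _; exact: ex_derive.
have dom_ge0 (x : R) : 0 <= `|x| * expR (- (s * x ^+ 2)) by rewrite mulr_ge0 ?expR_ge0.
have dom_ub (u x : R) : `]v - 1, v + 1[%classic u -> setT x ->
    `|partial1of2 f u x| <= `|x| * expR (- (s * x ^+ 2)).
  move=> _ _; rewrite d1f normrN !normrM (ger0_norm (expR_ge0 _)).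
  by rewrite ler_wpM2r ?expR_ge0// ler_piMr// ler_norml sin_geN1 sin_le1.
have int_dom := integrable_normr_expRN_sqr s0.
apply: (@DeriveDef _ _ _ _ _ _ _ _).
  exact: (derivable_under_integral measurableT vI intf derf dom_ge0 int_dom dom_ub).
rewrite -derive1E (differentiation_under_integral measurableT vI intf derf dom_ge0 int_dom dom_ub).
rewrite -mulN1r -RintegralZl//; last exact: integrable_sin_expRN_sqr.
by apply: eq_Rintegral => x _; rewrite d1f mulN1r.
Qed.

Lemma cos_expRN_sqr_by_parts (R : realType) (s v : R) : 0 < s ->
  v * \int[mu]_x (cos (v * x) * expR (- (s * x ^+ 2))) =
  2 * s * \int[mu]_x (x * sin (v * x) * expR (- (s * x ^+ 2))).
Proof.
move=> s0.
have ic := integrable_cos_expRN_sqr v s0.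
have is_ := integrable_sin_expRN_sqr v s0.
apply/eqP; rewrite -subr_eq0; apply/eqP.
rewrite -!RintegralZl// -RintegralB//; last 2 first.
- exact: (integrableZl measurableT v ic).
- exact: (integrableZl measurableT (2 * s) is_).
apply: (@integral_derive_eq0 _ (fun x => sin (v * x) * expR (- (s * x ^+ 2)))).
- by move=> x; apply: trigger_derive; rewrite /GRing.scale /=; ring.
- move=> x; apply/differentiable_continuous/derivable1_diffP.
  exact: ex_derive.
- exact: (integrableB measurableT (integrableZl measurableT v ic)
    (integrableZl measurableT (2 * s) is_)).
- exact: cvg_sin_expRN_sqr.
- apply/cvgNy_compNP.
  rewrite (_ : _ \o _ = - (fun x : R => sin (v * x) * expR (- (s * x ^+ 2)))).
    by have := cvgN (cvg_sin_expRN_sqr v s0); rewrite oppr0; exact.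
  by apply/funext => x /=; rewrite mulrN sinN sqrrN mulNr.
Qed.

(** Differentiating under the integral and integrating by parts shows that the
    transform solves [y' = - (v/(2s)) y]. *)
Lemma integral_cos_expRN_sqr (R : realType) (s v : R) : 0 < s ->
  \int[mu]_x (cos (v * x) * expR (- (s * x ^+ 2))) =
  Num.sqrt pi / Num.sqrt s * expR (- (v ^+ 2 / (4 * s))).
Proof.
move=> s0; pose phi (v : R) := \int[mu]_x (cos (v * x) * expR (- (s * x ^+ 2))).
have dphi (u : R) : is_derive u 1 phi (- (u / (2 * s)) * phi u).
  apply: is_derive_eq; first exact: is_derive_cos_expRN_sqr.
  have := cos_expRN_sqr_by_parts u s0; rewrite -/(phi u) => E.
  rewrite mulNr mulrAC E; congr -%R; field; lra.
have := @is_derive_0_is_cst R (fun u => phi u * expR (u ^+ 2 / (4 * s))) v 0.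
rewrite /= => E; rewrite -/(phi v).
have {E} : phi v * expR (v ^+ 2 / (4 * s)) = phi 0 * expR (0 ^+ 2 / (4 * s)).
  apply: E => u; apply: is_derive_eq.
  rewrite /GRing.scale /=; field; lra.
rewrite expr0n mul0r expR0 mulr1 => E.
rewrite expRN -(_ : phi 0 = Num.sqrt pi / Num.sqrt s).
  by rewrite -E mulfK ?gt_eqF ?expR_gt0.
rewrite /phi -[RHS]/(fine (_%:E)) -integral_expRN_sqr//; congr fine.
by apply: eq_integral => x _; rewrite mul0r cos0 mul1r.
Qed.

(** * An integral that covers the Gamma, Bessel and Matern functions *)

(** The density of a generalized inverse Gaussian law, up to normalization, in
    the coordinate [t = ln s]: no power function and no boundary at zero are
    left, and scaling [s] becomes a translation. *)
Definition gig_fun {R : realType} (n c q t : R) : R :=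
  expR (n * t - c * expR t - q * expR (- t)).

Definition gig_mass {R : realType} (n c q : R) : R :=
  \int[mu]_t gig_fun n c q t.

Lemma gig_fun_ge0 (R : realType) (n c q t : R) : 0 <= gig_fun n c q t.
Proof. exact: expR_ge0. Qed.

Lemma continuous_gig_fun (R : realType) (n c q : R) : continuous (gig_fun n c q).
Proof.
move=> x; apply/differentiable_continuous/derivable1_diffP; rewrite /gig_fun.
exact: ex_derive.
Qed.

Lemma integrable_expRN_normr (R : realType) (n : R) : 0 < n ->
  mu.-integrable setT (EFin \o (fun t : R => expR (- (n * `|t|)))).
Proof.
move=> n0.
have c : continuous (fun t : R => expR (- (n * `|t|))).
  move=> x; apply: (@continuous_comp _ _ _ (fun t : R => - (n * `|t|)) expR).
    apply: cvgN; apply: cvgMr; exact: norm_continuous.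
  exact: continuous_expR.
have mE : measurable_fun setT (EFin \o (fun t : R => expR (- (n * `|t|)))).
  by apply/measurable_EFinP; exact: continuous_measurable_fun.
apply/integrableP; split => //.
under eq_integral do rewrite /= ger0_norm ?expR_ge0//.
rewrite ge0_integral_fold//.
have -> : (\int[mu]_(x in `[0%R, +oo[) (expR (- (n * `|x|)) + expR (- (n * `|- x|)))%:E =
    \int[mu]_(x in `[0%R, +oo[) (2 * expR (- (n * x)))%:E)%E.
  apply: eq_integral => x /set_mem/=; rewrite in_itv/= andbT => x0.
  by rewrite normrN ger0_norm// mulr_natl mulr2n.
have dF (x : R) : is_derive x 1 (fun t => - (2 / n) * expR (- (n * t)))
                    (2 * expR (- (n * x))).
  apply: trigger_derive; rewrite /GRing.scale /=; field; lra.
rewrite (@ge0_continuous_FTC2y _ _ (fun t => - (2 / n) * expR (- (n * t))) 0 0).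
- by rewrite -EFinB ltry.
- by move=> x _; rewrite mulr_ge0 ?expR_ge0.
- apply: continuous_subspaceT => x; apply/differentiable_continuous/derivable1_diffP.
  exact: ex_derive.
- rewrite -[X in _ --> X](mulr0 (- (2 / n))); apply: cvgMr.
  apply: (@cvg_comp _ _ _ (fun t => n * t) (fun x => expR (- x))); last exact: cvgr_expR.
  exact: gt0_cvgMry.
- by move=> x _; exact: ex_derive.
- apply: cvg_at_right_filter.
  exact: (is_derive_continuous dF).
- by move=> x _; rewrite derive1E derive_val.
Qed.

(** For positive [t] the term [c * expR t] beats [2 * n * t] up to a constant,
    so the integrand decays like [expR (- n * `|t|)] on both sides. *)
Lemma integrable_gig_fun (R : realType) (n c q : R) : 0 < n -> 0 < c -> 0 <= q ->
  mu.-integrable setT (EFin \o gig_fun n c q).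
Proof.
move=> n0 c0 q0; pose s := ln (2 * n / c); pose C := expR (2 * n * `|s|).
have iC : mu.-integrable setT
    (fun x : R => (C%:E * (EFin \o (fun t => expR (- (n * `|t|)))) x)%E).
  by apply: integrableZl => //; exact: integrable_expRN_normr.
apply: le_integrable iC => //.
  apply/measurable_EFinP; apply: continuous_measurable_fun.
  exact: continuous_gig_fun.
move=> t _ /=; rewrite lee_fin ger0_norm ?gig_fun_ge0// ger0_norm; last first.
  by rewrite mulr_ge0 ?expR_ge0.
rewrite /C -expRD ler_expR.
have qt : 0 <= q * expR (- t) by rewrite mulr_ge0 ?expR_ge0.
have ns : 0 <= 2 * n * `|s| by rewrite !mulr_ge0// ltW.
have [t0|t0] := leP t 0.
  have : 0 < c * expR t by rewrite mulr_gt0 ?expR_gt0.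
  by rewrite (ler0_norm t0) mulrN opprK => ?; lra.
rewrite (gtr0_norm t0).
(* The tangent of [expR] at [s] is used because [c * expR s = 2 * n]. *)
have cE : c * expR t = 2 * n * expR (t - s).
  rewrite expRB /s lnK ?posrE ?divr_gt0 ?mulr_gt0//; field.
  by rewrite !gt_eqF.
have : 2 * n * (1 + (t - s)) <= c * expR t.
  by rewrite cE ler_wpM2l ?expR_ge1Dx// mulr_ge0// ltW.
have : 2 * n * s <= 2 * n * `|s| by rewrite ler_wpM2l ?ler_norm// mulr_ge0// ltW.
lra.
Qed.

Lemma EFin_gig_mass (R : realType) (n c q : R) : 0 < n -> 0 < c -> 0 <= q ->
  (\int[mu]_t (gig_fun n c q t)%:E = (gig_mass n c q)%:E)%E.
Proof.
move=> n0 c0 q0; rewrite /gig_mass /Rintegral fineK//.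
apply: integrable_fin_num => //; exact: integrable_gig_fun.
Qed.

(** Scaling [s = expR t] by [a] is translating [t] by [ln a]. *)
Lemma gig_mass_scale (R : realType) (n c q a : R) :
    0 < n -> 0 < c -> 0 <= q -> 0 < a ->
  gig_mass n c q = a `^ n * gig_mass n (c * a) (q / a).
Proof.
move=> n0 c0 q0 a0; rewrite /gig_mass -RintegralZl//; last first.
  by apply: integrable_gig_fun; rewrite ?mulr_gt0// mulr_ge0// invr_ge0 ltW.
rewrite /Rintegral (@ge0_integral_shift _ _ (ln a)); last 2 first.
- exact: continuous_gig_fun.
- by move=> x; exact: gig_fun_ge0.
congr fine; apply: eq_integral => t _; congr EFin.
rewrite /gig_fun /powR gt_eqF// -expRD; congr expR.
rewrite opprD !expRD !expRN lnK ?posrE//; ring.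
Qed.

Lemma GammaE (R : realType) (x : R) : Gamma x = gig_mass x 1 0.
Proof.
rewrite /Gamma /gig_mass /Rintegral ge0_integral_expR; first last.
- by move=> t; rewrite mulr_ge0 ?powR_ge0 ?expR_ge0.
- move=> t; rewrite in_itv/= andbT => t0.
  apply/differentiable_continuous/derivable1_diffP/derivableM.
    exact: (@ex_derive _ _ _ _ _ _ _ (is_derive1_powR _ t0)).
  exact: ex_derive.
congr fine; apply: eq_integral => t _; congr EFin.
rewrite /powR gt_eqF ?expR_gt0// expRK -!expRD; congr expR; ring.
Qed.

(** An integral equal to zero would force a positive function to vanish almost
    everywhere on the line, which has infinite measure. *)
Lemma gig_mass_gt0 (R : realType) (n c q : R) : 0 < n -> 0 < c -> 0 <= q ->
  0 < gig_mass n c q.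
Proof.
move=> n0 c0 q0; rewrite lt_neqAle eq_sym; apply/andP; split; last first.
  by apply: Rintegral_ge0 => t _; exact: gig_fun_ge0.
apply/eqP => W0.
have mG : measurable_fun setT (EFin \o gig_fun n c q).
  apply/measurable_EFinP; apply: continuous_measurable_fun.
  exact: continuous_gig_fun.
have : (\int[mu]_t `|(gig_fun n c q t)%:E| = 0)%E.
  under eq_integral do rewrite gee0_abs ?lee_fin ?gig_fun_ge0//.
  by rewrite EFin_gig_mass// W0.
move/(ae_eq_integral_abs mu measurableT mG) => [N [mN N0 sN]].
have : (mu setT <= mu N)%E.
  apply: le_measure; rewrite ?inE// => t _; apply: sN => /= /(_ Logic.I).
  by move=> [] /eqP; rewrite gt_eqF// expR_gt0.
by rewrite N0 -set_itvNyy lebesgue_measure_itv.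
Qed.

Lemma Gamma_gt0 (R : realType) (x : R) : 0 < x -> 0 < Gamma x.
Proof. by move=> x0; rewrite GammaE gig_mass_gt0. Qed.

(** Folding the line at [t = 0] turns [exp (nu t)] into [2 * cosh (nu t)], and
    [expR t + expR (- t) = 2 * cosh t]. *)
Lemma besselKE (R : realType) (nu z : R) : 0 < nu -> 0 < z ->
  besselK nu z = gig_mass nu (z / 2) (z / 2) / 2.
Proof.
move=> n0 z0; have z20 : 0 < z / 2 by rewrite divr_gt0.
rewrite /gig_mass -RintegralZr//; last first.
  by apply: integrable_gig_fun; rewrite // ltW.
rewrite /besselK /Rintegral ge0_integral_fold; last 2 first.
- by move=> t; apply: cvgMl; exact: continuous_gig_fun.
- by move=> t; rewrite mulr_ge0 ?gig_fun_ge0.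
congr fine; apply: eq_integral => t _; congr EFin.
rewrite /gig_fun /cosh opprK mulrA -!mulrDl mulrDr -!expRD.
by congr ((expR _ + expR _) / 2); field.
Qed.

(** Scaling by [z / 2], with [z = alpha * h], makes the two exponential rates
    equal, and then the integral is the one for [besselK].  At [h = 0], where
    [Matern] is 1, both sides are the Gamma integral. *)
Lemma Gamma_Matern (R : realType) (h alpha nu : R) : 0 < alpha -> 0 <= h ->
  0 < nu -> Gamma nu * Matern h alpha nu = gig_mass nu 1 ((alpha * h) ^+ 2 / 4).
Proof.
move=> a0 h0 n0; have G0 := Gamma_gt0 n0; rewrite /Matern.
have [->|hN0] := eqVneq h 0.
  by rewrite mulr1 mulr0 expr0n mul0r GammaE.
have z0 : 0 < alpha * h by rewrite mulr_gt0// lt_neqAle eq_sym hN0.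
move: (alpha * h) z0 => z z0.
rewrite (@gig_mass_scale _ _ _ _ (z / 2)) ?divr_gt0//; last first.
  by rewrite mulr_ge0 ?sqr_ge0.
rewrite mul1r (_ : z ^+ 2 / 4 / (z / 2) = z / 2); last by field; rewrite gt_eqF.
have -> : (2 : R) `^ (1 - nu) = 2 / 2 `^ nu.
  by rewrite powRB ?powRr1// pnatr_eq0 implybT.
have -> : (z / 2) `^ nu = z `^ nu / 2 `^ nu.
  rewrite powRM ?invr_ge0 ?ltW//; congr (_ * _).
  by rewrite -powR_inv1// -powRrM mulN1r powRN.
rewrite besselKE//; field.
by rewrite !gt_eqF ?powR_gt0.
Qed.

(** * Raising the dimension by one *)

Section cosine_mixture.
Context {R : realType}.
Variables (n c q : R).
Hypotheses (n_gt0 : 0 < n) (c_gt0 : 0 < c) (q_ge0 : 0 <= q).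

Let h (z : R * R) : R := gig_fun (n + 1 / 2) (c + z.1 ^+ 2) q z.2.

(* As a function of [x] the integrand is a Gaussian. *)
Let hE x t : h (x, t) = gig_fun (n + 1 / 2) c q t * expR (- (expR t * x ^+ 2)).
Proof. by rewrite /h /gig_fun /= -expRD; congr expR; ring. Qed.

Let measurable_h : measurable_fun setT h.
Proof.
rewrite /h /gig_fun; apply: measurableT_comp => //; apply: measurable_funB.
  apply: measurable_funB; first exact: measurable_funM.
  apply: measurable_funM; last exact: measurableT_comp.
  by apply: measurable_funD => //; exact: measurable_funX.
apply: measurable_funM => //; apply: measurableT_comp => //.
exact: measurableT_comp.
Qed.

(* The Gaussian integral contributes [expR (- t / 2)], which cancels the extra
   half unit of order. *)
Let expR_half_split v t :
  gig_fun (n + 1 / 2) c q t * (Num.sqrt pi / Num.sqrt (expR t) *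
    expR (- (v ^+ 2 / (4 * expR t)))) =
  Num.sqrt pi * gig_fun n c (q + v ^+ 2 / 4) t.
Proof.
have -> : Num.sqrt (expR t) = expR (t / 2).
  by rewrite {1}[t]splitr expRD -expr2 sqrtr_sqr ger0_norm ?expR_ge0.
rewrite -expRN mulrA mulrCA -!mulrA; congr (_ * _).
rewrite /gig_fun -!expRD; congr expR; rewrite [(4 * _)^-1]invfM -expRN; by field.
Qed.

Let integrable_h : (mu \x mu)%E.-integrable setT (EFin \o h).
Proof.
have mh : measurable_fun setT (EFin \o h) by apply/measurable_EFinP.
apply/(integrable21ltyP mu mu mh) => /=.
have inner t : (\int[mu]_x `|(h (x, t))%:E| =
    (Num.sqrt pi * gig_fun n c q t)%:E)%E.
  under eq_integral do rewrite gee0_abs ?lee_fin ?gig_fun_ge0// hE EFinM.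
  rewrite ge0_integralZl//; last 2 first.
  - apply/measurable_EFinP; apply: continuous_measurable_fun.
    exact: continuous_expRN_sqr.
  - by rewrite lee_fin gig_fun_ge0.
  rewrite integral_expRN_sqr ?expR_gt0// -EFinM; congr EFin.
  have := expR_half_split 0 t.
  by rewrite expr0n !mul0r oppr0 expR0 mulr1 addr0.
under eq_integral do rewrite inner EFinM.
rewrite ge0_integralZl//; last 2 first.
- apply/measurable_EFinP; apply: continuous_measurable_fun.
  exact: continuous_gig_fun.
- by move=> x _; rewrite lee_fin gig_fun_ge0.
by rewrite EFin_gig_mass// -EFinM ltry.
Qed.

Variable v : R.

Let f (z : R * R) : R := cos (v * z.1) * h z.

Let integrable_f : (mu \x mu)%E.-integrable setT (EFin \o f).
Proof.
apply: le_integrable integrable_h => //.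
  apply/measurable_EFinP; apply: measurable_funM => //.
  apply: (@measurableT_comp _ _ _ _ _ _ (fun x => cos (v * x))) => //.
  apply: measurableT_comp => //; apply: continuous_measurable_fun.
  exact: continuous_cos.
move=> z _; rewrite /= lee_fin normrM ler_piMl// ler_norml.
by rewrite cos_geN1 cos_le1.
Qed.

Let slice_f : (fun x => \int[mu]_t (f (x, t))%:E)%E =
  EFin \o (fun x => cos (v * x) * gig_mass (n + 1 / 2) (c + x ^+ 2) q).
Proof.
apply/funext => x /=.
have cx : 0 < c + x ^+ 2 by rewrite ltr_wpDr// sqr_ge0.
have n12 : 0 < n + 1 / 2 by rewrite addr_gt0.
rewrite EFinM -EFin_gig_mass// -integralZl//.
exact: integrable_gig_fun.
Qed.

Lemma integrable_cos_gig_mass :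
  mu.-integrable setT
    (EFin \o (fun x => cos (v * x) * gig_mass (n + 1 / 2) (c + x ^+ 2) q)).
Proof. rewrite -slice_f; exact: (integrable_fubini_F integrable_f). Qed.

(** Exchanging the integrals leaves, for each [t], the cosine transform of a
    Gaussian, whose value adds [v ^+ 2 / 4] to [q]. *)
Lemma cos_gig_mass :
  \int[mu]_x (cos (v * x) * gig_mass (n + 1 / 2) (c + x ^+ 2) q) =
  Num.sqrt pi * gig_mass n c (q + v ^+ 2 / 4).
Proof.
have qv : 0 <= q + v ^+ 2 / 4 by rewrite addr_ge0// divr_ge0 ?sqr_ge0.
rewrite {1}/Rintegral.
have -> : (\int[mu]_x (cos (v * x) * gig_mass (n + 1 / 2) (c + x ^+ 2) q)%:E =
    \int[mu]_x \int[mu]_t (f (x, t))%:E)%E by rewrite slice_f.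
rewrite (Fubini integrable_f) -RintegralZl//; last exact: integrable_gig_fun.
rewrite /Rintegral; congr fine; apply: eq_integral => t _.
have ic := integrable_cos_expRN_sqr v (expR_gt0 t).
rewrite -expR_half_split -integral_cos_expRN_sqr ?expR_gt0// -RintegralZl//.
rewrite /Rintegral fineK; last first.
  apply: integrable_fin_num => //.
  exact: (integrableZl measurableT (gig_fun (n + 1 / 2) c q t) ic).
apply: eq_integral => x _ /=; congr EFin.
by rewrite /f hE mulrCA.
Qed.

End cosine_mixture.

(** * Quadratic forms *)

Definition quad_ge0 {R : realType} {T : finType} (M : T -> T -> R) : Prop :=
  forall w : T -> R, 0 <= \sum_x \sum_y w x * w y * M x y.

Section quad_ge0.
Context {R : realType} {T : finType}.
Implicit Types M : T -> T -> R.

Lemma quad_ge0Z M (k : R) : 0 <= k -> quad_ge0 M ->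
  quad_ge0 (fun x y => k * M x y).
Proof.
move=> k0 M0 w; have := mulr_ge0 k0 (M0 w); rewrite big_distrr/=.
congr (_ <= _); apply: eq_bigr => x _; rewrite big_distrr/=.
by apply: eq_bigr => y _; rewrite mulrCA.
Qed.

(** [cos (a - b) = cos a * cos b + sin a * sin b] is a sum of two rank one
    kernels, and for these the Schur product theorem is a change of weights. *)
Lemma quad_ge0_cos M (s : T -> R) : quad_ge0 M ->
  quad_ge0 (fun x y => cos (s x - s y) * M x y).
Proof.
move=> M0 w.
have := addr_ge0 (M0 (fun x => w x * cos (s x))) (M0 (fun x => w x * sin (s x))).
rewrite -big_split/=; congr (_ <= _); apply: eq_bigr => x _.
rewrite -big_split/=; apply: eq_bigr => y _.
by rewrite cosB; ring.
Qed.

Lemma quad_ge0_integral (M : R -> T -> T -> R) :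
  (forall x y, mu.-integrable setT (EFin \o (fun t => M t x y))) ->
  (forall t, quad_ge0 (M t)) -> quad_ge0 (fun x y => \int[mu]_t M t x y).
Proof.
move=> iM M0 w.
have iwM x y : mu.-integrable setT (fun t => (w x * w y * M t x y)%:E).
  exact: (integrableZl measurableT (w x * w y) (iM x y)).
suff -> : \sum_x \sum_y w x * w y * \int[mu]_t M t x y =
    \int[mu]_t \sum_x \sum_y w x * w y * M t x y.
  by apply: Rintegral_ge0 => t _; exact: M0.
rewrite /Rintegral; under [in RHS]eq_integral.
  move=> t _; rewrite -sumEFin; under eq_bigr do rewrite -sumEFin; over.
rewrite /= integral_sum//; last first.
  by move=> x; apply: integrable_sum.
rewrite -sum_fine; last first.
  move=> x _; apply: integrable_fin_num => //.
  by apply: integrable_sum.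
apply: eq_bigr => x _; rewrite integral_sum// -sum_fine; last first.
  by move=> y _; apply: integrable_fin_num.
by apply: eq_bigr => y _; rewrite -[RHS]/(\int[mu]_t _) RintegralZl.
Qed.

(** Induction on the dimension: [cos_gig_mass] trades one coordinate of [u] for
    half a unit of the order [N]; in dimension zero the form is the given one
    at [a = c^-1]. *)
Lemma quad_ge0_gig_mass (B N : T -> T -> R) :
  (forall x y, 0 < N x y) ->
  (forall a, 0 < a <= 1 -> quad_ge0 (fun x y => B x y * a `^ N x y)) ->
  forall d (c : R) (u : T -> 'I_d -> R), 1 <= c ->
  quad_ge0 (fun x y => B x y *
    (gig_mass (N x y) c (\sum_i (u x i - u y i) ^+ 2 / 4) /
     Gamma (N x y + d%:R / 2))).
Proof.
move=> + + d; elim: d N => [|d IH] N N0 BN c u c1.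
  have c0 : 0 < c by rewrite (lt_le_trans _ c1).
  have c1' : 0 < c^-1 <= 1 by rewrite invr_gt0 c0 invf_le1.
  move=> w; have := BN _ c1' w; congr (_ <= _).
  apply: eq_bigr => x _; apply: eq_bigr => y _; congr (_ * (_ * _)).
  rewrite big_ord0 mul0r addr0 GammaE (@gig_mass_scale _ (N x y) c 0 c^-1) ?invr_gt0//.
  by rewrite divff ?gt_eqF// mul0r mulfK// gt_eqF// gig_mass_gt0.
have N20 x y : 0 < N x y + 1 / 2 by rewrite addr_gt0.
have BN2 a : 0 < a <= 1 -> quad_ge0 (fun x y => B x y * a `^ (N x y + 1 / 2)).
  move=> a01; have := quad_ge0Z (powR_ge0 a (1 / 2)) (BN a a01).
  move=> H w; have := H w; congr (_ <= _).
  apply: eq_bigr => x _; apply: eq_bigr => y _; congr (_ * _).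
  rewrite powRD; first by ring.
  by apply/implyP => _; rewrite gt_eqF//; case/andP: a01.
pose u' x i := u x (widen_ord (leqnSn d) i).
pose q x y := \sum_i (u' x i - u' y i) ^+ 2 / 4.
have q0 x y : 0 <= q x y.
  by apply: sumr_ge0 => i _; rewrite divr_ge0 ?sqr_ge0.
have c0 : 0 < c by rewrite (lt_le_trans _ c1).
(* [M t] is the integrand over the frequency [t] of the last coordinate. *)
pose g x y := B x y / Gamma (N x y + d.+1%:R / 2).
pose v x y := u x ord_max - u y ord_max.
pose M t x y :=
  g x y * (cos (v x y * t) * gig_mass (N x y + 1 / 2) (c + t ^+ 2) (q x y)).
have iM x y : mu.-integrable setT (EFin \o (fun t => M t x y)).
  have := integrable_cos_gig_mass (N0 x y) c0 (q0 x y) (v x y).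
  exact: (integrableZl measurableT (g x y)).
have M0 t : quad_ge0 (M t).
  have ct : 1 <= c + t ^+ 2 by rewrite ler_wpDr ?sqr_ge0.
  have := quad_ge0_cos (fun x => u x ord_max * t) (IH _ N20 BN2 _ u' ct).
  move=> H w; have := H w; congr (_ <= _).
  apply: eq_bigr => x _; apply: eq_bigr => y _; congr (_ * _).
  rewrite /M /g /v mulrBl -/(q x y).
  have -> : N x y + 1 / 2 + d%:R / 2 = N x y + d.+1%:R / 2.
    by rewrite -natr1; ring.
  by ring.
have := quad_ge0Z _ (quad_ge0_integral iM M0).
move=> /(_ (Num.sqrt pi)^-1); rewrite invr_ge0 sqrtr_ge0 => /(_ isT) H w.
have := H w; congr (_ <= _).
apply: eq_bigr => x _; apply: eq_bigr => y _; congr (_ * _).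
rewrite RintegralZl//; last exact: integrable_cos_gig_mass.
rewrite cos_gig_mass// big_ord_recr/= -/(q x y) /g.
by field; rewrite !gt_eqF ?sqrtr_gt0 ?pi_gt0// Gamma_gt0// addr_gt0// divr_gt0.
Qed.

End quad_ge0.

(** * Positive definite kernels on products of spheres and a Euclidean space *)

(** Points and vector components merge into one finite index, so that a
    matrix-valued kernel becomes a scalar quadratic form. *)
Lemma sum_bilinear_form (R : realType) (n p : nat)
    (G : 'I_n -> 'I_n -> 'M[R]_p) (a : 'I_n -> 'cV[R]_p) :
  \sum_(k < n) \sum_(h < n) ((a k)^T *m G k h *m a h) 0 0 =
  \sum_(x : 'I_n * 'I_p) \sum_(y : 'I_n * 'I_p)
     a x.1 x.2 0 * a y.1 y.2 0 * G x.1 y.1 x.2 y.2.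
Proof.
under eq_bigr => k _.
  under eq_bigr => h _.
    rewrite -mulmxA mxE.
    under eq_bigr => i _ do rewrite !mxE big_distrr/=.
    over.
  rewrite exchange_big/=.
  over.
rewrite pair_big/=; apply: eq_bigr => -[k i] _ /=.
rewrite pair_big/=; apply: eq_bigr => -[h j] _ /=.
by ring.
Qed.

Lemma dotvC (R : realType) n (x y : 'rV[R]_n) : dotv x y = dotv y x.
Proof. by apply: eq_bigr => i _; rewrite mulrC. Qed.

Lemma enorm_sqr (R : realType) n (x : 'rV[R]_n) : enorm x ^+ 2 = dotv x x.
Proof.
by rewrite sqr_sqrtr// sumr_ge0// => i _; rewrite -expr2 sqr_ge0.
Qed.

Lemma enorm_distC (R : realType) n (x y : 'rV[R]_n) : enorm (x - y) = enorm (y - x).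
Proof.
congr Num.sqrt; apply: eq_bigr => i _.
by rewrite -(opprB y x) !mxE; ring.
Qed.

Lemma dotv_sphere (R : realType) n (x y : 'rV[R]_n.+1) :
  sphere n x -> sphere n y -> -1 <= dotv x y <= 1.
Proof.
rewrite /sphere/= => x1 y1.
have xx : dotv x x = 1 by rewrite -enorm_sqr x1 expr1n.
have yy : dotv y y = 1 by rewrite -enorm_sqr y1 expr1n.
have D : 0 <= \sum_i (x 0 i + y 0 i) ^+ 2 by apply: sumr_ge0 => i _; rewrite sqr_ge0.
have S : 0 <= \sum_i (x 0 i - y 0 i) ^+ 2 by apply: sumr_ge0 => i _; rewrite sqr_ge0.
have : \sum_i (x 0 i + y 0 i) ^+ 2 = dotv x x + 2 * dotv x y + dotv y y.
  rewrite /dotv mulr_sumr -!big_split/=; apply: eq_bigr => i _; ring.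
have : \sum_i (x 0 i - y 0 i) ^+ 2 = dotv x x + -2 * dotv x y + dotv y y.
  rewrite /dotv mulr_sumr -!big_split/=; apply: eq_bigr => i _; ring.
rewrite xx yy; lra.
Qed.

Theorem theorem3p6 (R : realType) (p d d1 d2 : nat)
  (p_gt0 : (0 < p)%N) (d_gt0 : (0 < d)%N)
  (d1_gt0 : (0 < d1)%N) (d2_gt0 : (0 < d2)%N)
  (alpha : R) (alpha_gt0 : 0 < alpha)
  (sigma : 'I_p -> R) (sigma_gt0 : forall i, 0 < sigma i)
  (nu : 'I_p -> 'I_p -> R -> R -> R)
  (nu_cont : forall i j,
    {within `[-1, 1] `*` `[-1, 1],
      continuous (fun z : R * R => nu i j z.1 z.2)})
  (nu_gt0 : forall i j (s r : R),
    -1 <= s <= 1 -> -1 <= r <= 1 -> 0 < nu i j s r)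
  (nu_mean : forall i j (s r : R),
    -1 <= s <= 1 -> -1 <= r <= 1 ->
    nu i j s r = (nu i i s r + nu j j s r) / 2)
  (beta : 'M[R]_p) (beta_diag : forall i, beta i i = 1)
  (rho : 'I_p -> 'I_p -> R -> R -> R)
  (rhoE : forall i j (s r : R),
    -1 <= s <= 1 -> -1 <= r <= 1 ->
    rho i j s r =
      beta i j * (Gamma (nu i j s r) / Gamma (nu i j s r + d%:R / 2)))
  (beta_posdef : forall a : R, 0 < a <= 1 ->
    posdef_torus d1 d2
      (fun s r => \matrix_(i < p, j < p) (beta i j * a `^ nu i j s r)))
  (K : R -> R -> R -> 'M[R]_p)
  (KE : forall (s r h : R) i j,
    -1 <= s <= 1 -> -1 <= r <= 1 -> 0 <= h ->
    K s r h i j =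
      sigma i * sigma j * rho i j s r * Matern h alpha (nu i j s r)) :
  posdef_torus_space d1 d2 d K.
Proof.
have K_gig s r h i j : -1 <= s <= 1 -> -1 <= r <= 1 -> 0 <= h ->
    K s r h i j = sigma i * sigma j * (beta i j *
      (gig_mass (nu i j s r) 1 ((alpha * h) ^+ 2 / 4) /
       Gamma (nu i j s r + d%:R / 2))).
  move=> s1 r1 h0; rewrite KE// rhoE// -Gamma_Matern//; last exact: nu_gt0.
  by ring.
split.
  move=> [[x1 x2] x] [[y1 y2] y] [[/= X1 X2] _] [[/= Y1 Y2] _].
  have s1 := dotv_sphere X1 Y1; have r1 := dotv_sphere X2 Y2.
  rewrite (dotvC y1) (dotvC y2) (enorm_distC y).
  have betaC i j : beta i j = beta j i.
    have [|sym _] := beta_posdef 1; first by rewrite ltr01 lexx.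
    have := sym (x1, x2) (y1, y2); rewrite /= (dotvC y1) (dotvC y2).
    move=> /(_ (conj X1 X2) (conj Y1 Y2)) /matrixP/(_ i j).
    by rewrite !mxE !powR1 !mulr1.
  apply/matrixP => i j; rewrite mxE !K_gig ?sqrtr_ge0//.
  by rewrite (betaC j i) (nu_mean j i)// (nu_mean i j)// [nu j j _ _ + _]addrC
    (mulrC (sigma j)).
move=> n x a Xx; rewrite sum_bilinear_form.
pose s (k h : 'I_n) := dotv (x k).1.1 (x h).1.1.
pose r (k h : 'I_n) := dotv (x k).1.2 (x h).1.2.
have s1 k h : -1 <= s k h <= 1.
  by apply: dotv_sphere; [case: (Xx k) => -[]|case: (Xx h) => -[]].
have r1 k h : -1 <= r k h <= 1.
  by apply: dotv_sphere; [case: (Xx k) => -[]|case: (Xx h) => -[]].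
pose T : finType := ('I_n * 'I_p)%type.
pose B (X Y : T) := beta X.2 Y.2.
pose N (X Y : T) := nu X.2 Y.2 (s X.1 Y.1) (r X.1 Y.1).
have N0 X Y : 0 < N X Y by exact: nu_gt0.
have BN b : 0 < b <= 1 -> quad_ge0 (fun X Y => B X Y * b `^ N X Y).
  move=> b01 w; have [_ pos] := beta_posdef b b01.
  have := pos n (fun k => (x k).1) (fun k => \col_i w (k, i)).
  rewrite sum_bilinear_form => /(_ (fun k => (Xx k).1)); congr (_ <= _).
  apply: eq_bigr => -[k i] _; apply: eq_bigr => -[h j] _.
  by rewrite !mxE.
pose u (X : T) (i : 'I_d) := alpha * (x X.1).2 0 i.
have := quad_ge0_gig_mass N0 BN u (lexx 1) (fun X => a X.1 X.2 0 * sigma X.2).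
congr (_ <= _); apply: eq_bigr => -[k i] _; apply: eq_bigr => -[h j] _ /=.
rewrite K_gig ?sqrtr_ge0//; last 2 first.
- exact: s1.
- exact: r1.
have -> : (alpha * enorm ((x k).2 - (x h).2)) ^+ 2 / 4 =
    \sum_l (u (k, i) l - u (h, j) l) ^+ 2 / 4.
  rewrite exprMn enorm_sqr /dotv mulr_sumr mulr_suml.
  by apply: eq_bigr => l _; rewrite /u/= !mxE; ring.
by rewrite /N/= /B/= -/(s k h) -/(r k h); ring.
Qed.
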